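(* Let $\beta\in\mathbb R$, $1\le n\le3$, $0<\alpha\le1$, $\rho_\pm>0$ and $u_\pm\in\mathbb R$ with $u_-<u_+$. For $A,B>0$ such that $(\rho_+,u_+)$ lies in region $\mathrm I$ (relative to $(\rho_-,u_-)$ and the pressure $P(\rho)=A\rho^n-B\rho^{-\alpha}$), let $(\rho^{AB},u^{AB})$ be the two-rarefaction-wave Riemann solution of $$\rho_t+(\rho u)_x=0,\qquad (\rho u)_t+(\rho u^2+P)_x=\beta\rho,\qquad (\rho,u)(x,0)=(\rho_\pm,u_\pm)\ \text{ for }\pm x>0 .$$ Then, as $A,B\to0^+$, the limit of $(\rho^{AB},u^{AB})$ consists of two contact discontinuities $x=u_\pm t+\frac12\beta t^2$ connecting the states $(\rho_\pm,u_\pm+\beta t)$ and an intermediate vacuum state: $$(\rho,u)(x,t)=\begin{cases}(\rho_-,u_-+\beta t),& -\infty<x<u_-t+\frac12\beta t^2,\\ \text{vacuum},& u_-t+\frac12\beta t^2<x<u_+t+\frac12\beta t^2,\\ (\rho_+,u_++\beta t),& u_+t+\frac12\beta t^2<x<\infty,\end{cases}$$ that is, for every $t>0$ and every $x$ in one of the two outer regions, $(\rho^{AB},u^{AB})(x,t)$ converges to the indicated state, and for every $x$ in the middle region $\rho^{AB}(x,t)\to0$. This limit is exactly the Riemann solution of $\rho_t+(\rho u)_x=0$, $(\rho u)_t+(\rho u^2)_x=\beta\rho$ with the same initial data.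
   Context: Write $c(\rho)=\sqrt{An\rho^{n-1}+\alpha B\rho^{-\alpha-1}}$. Region $\mathrm I$: $(\rho_+,u_+)\in\mathrm I$ means $u_+-u_->\left|\int_{\rho_-}^{\rho_+}\frac{c(s)}{s}\,ds\right|$, i.e. in the $(\rho,v)$ half-plane ($v=u-\beta t$) the point lies to the right of the 1- and 2-rarefaction curves through $(\rho_-,u_-)$. Limits are taken over $A,B>0$ for which this holds. Two-rarefaction-wave Riemann solution: the constants $0<\rho_*^{AB}<\min\{\rho_-,\rho_+\}$ and $v_*^{AB}$ are determined by $v_*^{AB}-u_-=\int_{\rho_*^{AB}}^{\rho_-}\frac{c(s)}{s}ds$ and $u_+-v_*^{AB}=\int_{\rho_*^{AB}}^{\rho_+}\frac{c(s)}{s}ds$. Put $\xi=(x-\frac12\beta t^2)/t$ and $u=v+\beta t$. Then: - $(\rho,u)=(\rho_-,u_-+\beta t)$ for $\xi<u_--c(\rho_-)$; - (1-rarefaction) for $u_--c(\rho_-)<\xi<v_*^{AB}-c(\rho_*^{AB})$, $(\rho,v)$ is given by $\xi=v-c(\rho)$, $v-u_-=\int_\rho^{\rho_-}\frac{c(s)}{s}ds$, $\rho_*^{AB}\le\rho\le\rho_-$; - $(\rho,u)=(\rho_*^{AB},v_*^{AB}+\beta t)$ for $v_*^{AB}-c(\rho_*^{AB})<\xi<v_*^{AB}+c(\rho_*^{AB})$; - (2-rarefaction) for $v_*^{AB}+c(\rho_*^{AB})<\xi<u_++c(\rho_+)$, $(\rho,v)$ is given by $\xi=v+c(\rho)$,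 $u_+-v=\int_\rho^{\rho_+}\frac{c(s)}{s}ds$, $\rho_*^{AB}\le\rho\le\rho_+$; - $(\rho,u)=(\rho_+,u_++\beta t)$ for $\xi>u_++c(\rho_+)$. Vacuum means $\rho=0$ (the velocity is not specified there). For $u_-<u_+$ the Riemann solution of the limit system is, by construction along characteristics $\frac{dx}{dt}=u$, $\frac{du}{dt}=\beta$, the two-contact-discontinuity function with intermediate vacuum displayed in the claim. *)

(* Defs.v *)
From Stdlib Require Import Reals.
From Coquelicot Require Import Coquelicot.
Open Scope R_scope.

(* c^2 = P' for P(rho) = A rho^n - B rho^(-alpha), with real exponents n, alpha
   and rho > 0. *)
Definition sound_speed (n alpha A B rho : R) : R :=
  sqrt (A * n * Rpower rho (n - 1) + alpha * B * Rpower rho (- alpha - 1)).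

(* int_a^b c(s)/s ds, the jump of v = u - beta t across a rarefaction wave. *)
Definition rarefaction_integral (n alpha A B a b : R) : R :=
  RInt (fun s => sound_speed n alpha A B s / s) a b.

Definition region_I (n alpha rhom um rhop up A B : R) : Prop :=
  up - um > Rabs (rarefaction_integral n alpha A B rhom rhop).

(* Functions of (x, t), constrained for t > 0 only.  The solution is continuous,
   so the fan formulas are imposed up to the edges of the fans, where they agree
   with the neighbouring constant states. *)
Definition two_rarefaction_solution
    (beta n alpha rhom um rhop up A B : R) (rho u : R -> R -> R) : Prop :=
  let c := sound_speed n alpha A B in
  let I := rarefaction_integral n alpha A B in
  exists rhos vs : R,
    0 < rhos < Rmin rhom rhop /\
    vs - um = I rhos rhom /\
    up - vs = I rhos rhop /\
    forall x t : R, 0 < t ->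
      let xi := (x - / 2 * beta * t ^ 2) / t in
      let v := u x t - beta * t in
      (xi < um - c rhom -> rho x t = rhom /\ u x t = um + beta * t) /\
      (um - c rhom <= xi <= vs - c rhos ->
         rhos <= rho x t <= rhom /\
         xi = v - c (rho x t) /\ v - um = I (rho x t) rhom) /\
      (vs - c rhos < xi < vs + c rhos ->
         rho x t = rhos /\ u x t = vs + beta * t) /\
      (vs + c rhos <= xi <= up + c rhop ->
         rhos <= rho x t <= rhop /\
         xi = v + c (rho x t) /\ up - v = I (rho x t) rhop) /\
      (up + c rhop < xi -> rho x t = rhop /\ u x t = up + beta * t).

(* The curve x = w t + beta t^2 / 2. *)
Definition contact (beta w t : R) : R := w * t + / 2 * beta * t ^ 2.

(* The velocity in the vacuum and the values on the two contact curves are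
   left unspecified. *)
Definition two_contacts_with_vacuum
    (beta rhom um rhop up : R) (rho u : R -> R -> R) : Prop :=
  forall x t : R, 0 < t ->
    (x < contact beta um t -> rho x t = rhom /\ u x t = um + beta * t) /\
    (contact beta um t < x < contact beta up t -> rho x t = 0) /\
    (contact beta up t < x -> rho x t = rhop /\ u x t = up + beta * t).

Definition riemann_data (l r x : R) : R := if Rlt_dec x 0 then l else r.

(* C^1 functions whose support in {t >= 0} lies in [-M, M] x [0, M]. *)
Definition test_function (phi : R -> R -> R) (M : R) : Prop :=
  0 < M /\
  (forall x t, M <= Rabs x \/ M <= t -> phi x t = 0) /\
  (forall x t, ex_derive (fun y => phi y t) x /\ ex_derive (fun s => phi x s) t) /\
  (forall x t,
     continuity_2d_pt (fun y s => Derive (fun z => phi z s) y) x t /\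
     continuity_2d_pt (fun y s => Derive (fun r => phi y r) s) x t).

(* q_t + f_x = g on t > 0 with q(., 0) = q0, in the sense of distributions:
   int int (q phi_t + f phi_x + g phi) dx dt + int q0 phi(x, 0) dx = 0. *)
Definition weak_balance_law (q f g : R -> R -> R) (q0 : R -> R) : Prop :=
  forall (phi : R -> R -> R) (M : R), test_function phi M ->
    let h t x := q x t * Derive (fun s => phi x s) t
                 + f x t * Derive (fun y => phi y t) x
                 + g x t * phi x t in
    (forall t, 0 < t -> ex_RInt (h t) (- M) M) /\
    is_RInt (fun t => RInt (h t) (- M) M) 0 M
            (- RInt (fun x => q0 x * phi x 0) (- M) M).

Definition pressureless_weak_solution
    (beta : R) (rho0 u0 : R -> R) (rho u : R -> R -> R) : Prop :=
  weak_balance_law rho (fun x t => rho x t * u x t) (fun _ _ => 0) rho0 /\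
  weak_balance_law (fun x t => rho x t * u x t)
                   (fun x t => rho x t * u x t ^ 2)
                   (fun x t => beta * rho x t)
                   (fun x => rho0 x * u0 x).

(* dX/dt = U, dU/dt = beta, issued from x0 with velocity w. *)
Definition characteristic (beta x0 w : R) (X U : R -> R) : Prop :=
  X 0 = x0 /\ U 0 = w /\
  forall t, is_derive X t (U t) /\ is_derive U t beta.

(* Riemann solution of rho_t + (rho u)_x = 0, (rho u)_t + (rho u^2)_x = beta rho
   for um < up: a weak solution built along characteristics.  Since the data are
   constant on each side, u_x = 0 on the regions covered by characteristics and
   the density is constant along them.  Points reached by no characteristic are
   in the vacuum; both velocities are issued from the origin, and these two
   limiting characteristics bound the vacuum. *)
Definition pressureless_riemann_solution
    (beta rhom um rhop up : R) (rho u : R -> R -> R) : Prop :=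
  pressureless_weak_solution beta
    (riemann_data rhom rhop) (riemann_data um up) rho u /\
  (forall x0 X U, x0 < 0 -> characteristic beta x0 um X U ->
     forall t, 0 < t -> rho (X t) t = rhom /\ u (X t) t = U t) /\
  (forall x0 X U, 0 < x0 -> characteristic beta x0 up X U ->
     forall t, 0 < t -> rho (X t) t = rhop /\ u (X t) t = U t) /\
  (forall x t, 0 < t ->
     (forall x0 w X U,
        (x0 <= 0 /\ w = um) \/ (0 <= x0 /\ w = up) ->
        characteristic beta x0 w X U -> X t <> x) ->
     rho x t = 0).

(* A, B -> 0+ jointly, along the pairs (A, B) for which region I holds. *)
Definition vanishing_pressure (n alpha rhom um rhop up : R) :
    (R * R -> Prop) -> Prop :=
  within (fun AB => region_I n alpha rhom um rhop up (fst AB) (snd AB))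
         (filter_prod (at_right 0) (at_right 0)).

(* Main.v *)
(** As the pressure vanishes, so do the sound speeds at the two data, so the
outer edges of the fans tend to the curves of slope [um] and [up] (in [xi]).
Strictly between them, a density above some [e > 0] would force [xi] within the
rarefaction integral over [[rho, rhom]] of [um], or over [[rho, rhop]] of [up]
(or, on the intermediate state, force [up - um] to be the sum of the two); these
integrals tend to 0 since [c(s)/s] is uniformly small for [s >= e].

For the limit system, a density [k] carried along a curve [X] with velocity
[w = X'] pairs with a test function [phi] to give
[d/dt (k(t) int_a^(X t) phi(x, t) dx)
   = int_a^(X t) (k phi_t + k w phi_x + k' phi)(x, t) dx]
whenever [phi(a, .) = 0]; integrating in [t] over each side of the vacuum is the
weak formulation. *)

Require Import Defs.
From Stdlib Require Import Reals Lra Psatz.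
From Coquelicot Require Import Coquelicot.
Open Scope R_scope.

(** * The vanishing pressure limit *)

Lemma Rpower_le_base_neg (x y p : R) :
  0 < x <= y -> p <= 0 -> Rpower y p <= Rpower x p.
Proof.
  intros Hxy Hp.
  replace p with (- - p) by ring.
  rewrite (Rpower_Ropp y), (Rpower_Ropp x).
  apply Rinv_le_contravar; [apply exp_pos | apply Rle_Rpower_l; lra].
Qed.

Lemma sound_speed_ge0 (n alpha A B s : R) : 0 <= sound_speed n alpha A B s.
Proof. apply sqrt_pos. Qed.

(** The term in [A] is nondecreasing in [s] because n >= 1, and the term in [B] is decreasing, so
    each is taken at its worst end of [e, b]. The bound has the shape sqrt(A p + B q) with p and q
    free of [A] and [B]. *)
Lemma sound_speed_le (n alpha A B e b s : R) :
  1 <= n -> 0 < alpha -> 0 < A -> 0 < B -> 0 < e <= s -> s <= b ->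
  sound_speed n alpha A B s <=
  sqrt (A * (n * Rpower b (n - 1)) + B * (alpha * Rpower e (- alpha - 1))).
Proof.
  intros Hn Ha HA HB He Hb.
  apply sqrt_le_1_alt.
  assert (H1 := Rle_Rpower_l s b (n - 1) ltac:(lra) ltac:(lra)).
  assert (H2 := Rpower_le_base_neg e s (- alpha - 1) ltac:(lra) ltac:(lra)).
  apply Rplus_le_compat.
  - rewrite Rmult_assoc; apply Rmult_le_compat_l; [lra |].
    apply Rmult_le_compat_l; lra.
  - rewrite (Rmult_comm alpha), Rmult_assoc; apply Rmult_le_compat_l; [lra |].
    apply Rmult_le_compat_l; lra.
Qed.

Lemma continuous_sound_speed_div (n alpha A B s : R) :
  0 < s -> continuous (fun s => sound_speed n alpha A B s / s) s.
Proof.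
  intros Hs; unfold sound_speed, Rdiv.
  apply (continuous_mult (K := R_AbsRing)).
  - apply (continuous_comp _ sqrt); [| apply continuous_sqrt].
    apply (ex_derive_continuous (V := R_NormedModule)); unfold Rpower; auto_derive; lra.
  - apply continuous_Rinv; lra.
Qed.

(** The integrand is at most S/e and the interval has length at most [m]. The bound is uniform in
    [r] and [b], as needed for a density that varies with [A] and [B]. *)
Lemma rarefaction_integral_le (n alpha A B e r b m : R) :
  1 <= n -> 0 < alpha -> 0 < A -> 0 < B -> 0 < e <= r -> r <= b -> b <= m ->
  rarefaction_integral n alpha A B r b <=
  m * (sqrt (A * (n * Rpower m (n - 1)) + B * (alpha * Rpower e (- alpha - 1))) / e).
Proof.
  intros Hn Ha HA HB He Hr Hb.
  set (S := sqrt _).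
  assert (HS : 0 <= S) by apply sqrt_pos.
  assert (HSe : 0 <= S / e) by (apply Rdiv_le_0_compat; lra).
  unfold rarefaction_integral.
  apply Rle_trans with (RInt (fun _ => S / e) r b).
  - apply RInt_le; [lra | | apply ex_RInt_const |].
    + apply (ex_RInt_continuous (V := R_CompleteNormedModule)); intros z.
      rewrite Rmin_left, Rmax_right by lra.
      intros Hz; apply continuous_sound_speed_div; lra.
    + intros s Hs; unfold Rdiv; apply Rmult_le_compat.
      * apply sound_speed_ge0.
      * left; apply Rinv_0_lt_compat; lra.
      * apply sound_speed_le; lra.
      * apply Rinv_le_contravar; lra.
  - rewrite RInt_const; apply Rmult_le_compat_r; lra.
Qed.

(** Turns a limit along the filter into an estimate: if [A] and [B] are below d^2/(p + q + 1), then
    A p + B q < d^2. The 1 keeps the denominator positive when p = q = 0. *)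
Lemma vanishing_pressure_small (n alpha rhom um rhop up p q d : R)
    (P : R * R -> Prop) :
  0 <= p -> 0 <= q -> 0 < d ->
  (forall A B, 0 < A -> 0 < B -> region_I n alpha rhom um rhop up A B ->
     sqrt (A * p + B * q) < d -> P (A, B)) ->
  vanishing_pressure n alpha rhom um rhop up P.
Proof.
  intros Hp Hq Hd HP.
  assert (He : 0 < d ^ 2 / (p + q + 1)).
  { apply Rdiv_lt_0_compat; [apply pow_lt |]; lra. }
  set (e := d ^ 2 / (p + q + 1)) in He.
  assert (Hsmall : at_right 0 (fun A => 0 < A < e)).
  { exists (mkposreal e He); intros y Hy Hy0.
    apply Rabs_def2 in Hy; unfold minus, plus, opp in Hy; simpl in Hy; lra. }
  exists (fun A => 0 < A < e) (fun B => 0 < B < e); [exact Hsmall | exact Hsmall |].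
  intros A B HA HB HI; apply HP; try easy.
  rewrite <- (sqrt_pow2 d) by lra.
  apply sqrt_lt_1_alt; split.
  - apply Rplus_le_le_0_compat; apply Rmult_le_pos; lra.
  - replace (d ^ 2) with (e * (p + q + 1)) by (unfold e; field; lra).
    nra.
Qed.

Lemma filterlim_of_eventually_eq {T : Type} (F : (T -> Prop) -> Prop) {FF : Filter F}
    (f : T -> R) (l : R) : F (fun x => f x = l) -> filterlim f F (locally l).
Proof.
  intros H; apply (filterlim_ext_loc (fun _ => l)); [| apply filterlim_const].
  revert H; apply filter_imp; intros x Hx; now rewrite Hx.
Qed.

Lemma vanishing_pressure_sound_speed (n alpha rhom um rhop up r d : R)
    (P : R * R -> Prop) :
  1 <= n -> 0 < alpha -> 0 < d ->
  (forall A B, 0 < A -> 0 < B -> region_I n alpha rhom um rhop up A B ->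
     sound_speed n alpha A B r < d -> P (A, B)) ->
  vanishing_pressure n alpha rhom um rhop up P.
Proof.
  intros Hn Ha Hd HP.
  assert (H1 : 0 < Rpower r (n - 1)) by apply exp_pos.
  assert (H2 : 0 < Rpower r (- alpha - 1)) by apply exp_pos.
  apply (vanishing_pressure_small _ _ _ _ _ _
           (n * Rpower r (n - 1)) (alpha * Rpower r (- alpha - 1)) d);
    [nra | nra | lra |].
  intros A B HA HB HI Hs; apply HP; try easy.
  revert Hs; unfold sound_speed; apply Rle_lt_trans, Req_le; f_equal; ring.
Qed.

Lemma two_rarefaction_density_le
    (beta n alpha rhom um rhop up A B e d x t : R) (rho u : R -> R -> R) :
  1 <= n -> 0 < alpha -> 0 < A -> 0 < B -> 0 < e ->
  um + d < (x - / 2 * beta * t ^ 2) / t < up - d -> 0 < d -> 0 < t ->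
  Rmax rhom rhop *
    (sqrt (A * (n * Rpower (Rmax rhom rhop) (n - 1)) +
           B * (alpha * Rpower e (- alpha - 1))) / e) < d ->
  two_rarefaction_solution beta n alpha rhom um rhop up A B rho u ->
  0 < rho x t <= e.
Proof.
  intros Hn Ha HA HB He Hxi Hd Ht HD (rhos & vs & Hrhos & Hm & Hp & H).
  specialize (H x t Ht); cbv zeta in H.
  set (xi := (x - / 2 * beta * t ^ 2) / t) in *.
  destruct H as (H1 & H2 & H3 & H4 & H5).
  assert (Hc := sound_speed_ge0 n alpha A B).
  assert (Hcm := Hc rhom). assert (Hcp := Hc rhop).
  assert (Hml := Rmin_l rhom rhop). assert (Hmr := Rmin_r rhom rhop).
  assert (HMl := Rmax_l rhom rhop). assert (HMr := Rmax_r rhom rhop).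
  (* Across any part of a fan with density above [e], the velocity changes by less than the margin
     [d]. *)
  assert (Hb : forall r b, e < r -> r <= b -> b <= Rmax rhom rhop ->
    rarefaction_integral n alpha A B r b < d).
  { intros r b Hr Hrb HbM; eapply Rle_lt_trans; [| exact HD].
    apply rarefaction_integral_le; lra. }
  destruct (Rle_lt_dec (um - sound_speed n alpha A B rhom) xi) as [K1 | K1]; [| lra].
  destruct (Rle_lt_dec xi (vs - sound_speed n alpha A B rhos)) as [K2 | K2].
  (* 1-fan: c >= 0 gives xi <= v, and v is um plus an integral below [d] if the density exceeds [e];
     this contradicts um + d < xi. *)
  { destruct (H2 (conj K1 K2)) as (R1 & R2 & R3).
    split; [lra |].
    destruct (Rle_lt_dec (rho x t) e) as [Hle | Hgt]; [exact Hle | exfalso].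
    specialize (Hb (rho x t) rhom). specialize (Hc (rho x t)). lra. }
  destruct (Rlt_le_dec xi (vs + sound_speed n alpha A B rhos)) as [K3 | K3].
  (* Intermediate state: up - um is the sum of two integrals below [d], whereas the margins around
     [xi] force it above 2d. *)
  { destruct (H3 (conj K2 K3)) as (R1 & R2).
    split; [lra |].
    destruct (Rle_lt_dec (rho x t) e) as [Hle | Hgt]; [exact Hle | exfalso].
    assert (B1 := Hb rhos rhom). assert (B2 := Hb rhos rhop). lra. }
  destruct (Rle_lt_dec xi (up + sound_speed n alpha A B rhop)) as [K4 | K4]; [| lra].
  (* 2-fan, the mirror image: xi >= v > up - d. *)
  destruct (H4 (conj K3 K4)) as (R1 & R2 & R3).
  split; [lra |].
  destruct (Rle_lt_dec (rho x t) e) as [Hle | Hgt]; [exact Hle | exfalso].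
  specialize (Hb (rho x t) rhop). specialize (Hc (rho x t)). lra.
Qed.

Lemma two_rarefaction_limit (beta n alpha rhom rhop um up : R)
    (hn : 1 <= n <= 3) (halpha : 0 < alpha <= 1)
    (hrhom : 0 < rhom) (hrhop : 0 < rhop) (hu : um < up)
    (rhoAB uAB : R -> R -> R -> R -> R)
    (hAB : forall A B : R, 0 < A -> 0 < B ->
       region_I n alpha rhom um rhop up A B ->
       two_rarefaction_solution beta n alpha rhom um rhop up A B
         (rhoAB A B) (uAB A B))
    (x t : R) (Ht : 0 < t) :
  let F := vanishing_pressure n alpha rhom um rhop up in
  let rho_xt := fun AB : R * R => rhoAB (fst AB) (snd AB) x t in
  let u_xt := fun AB : R * R => uAB (fst AB) (snd AB) x t in
  (x < contact beta um t ->
     filterlim rho_xt F (locally rhom) /\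
     filterlim u_xt F (locally (um + beta * t))) /\
  (contact beta um t < x < contact beta up t ->
     filterlim rho_xt F (locally 0)) /\
  (contact beta up t < x ->
     filterlim rho_xt F (locally rhop) /\
     filterlim u_xt F (locally (up + beta * t))).
Proof.
  cbv zeta.
  set (xi := (x - / 2 * beta * t ^ 2) / t).
  (* In the variable [xi] the contact of initial velocity [w] sits at the value [w] for every t >
     0. *)
  assert (Hl : forall w, x < contact beta w t -> 0 < w - xi).
  { intros w Hw; replace (w - xi) with ((contact beta w t - x) / t)
      by (unfold contact, xi; field; lra).
    apply Rdiv_lt_0_compat; lra. }
  assert (Hr : forall w, contact beta w t < x -> 0 < xi - w).
  { intros w Hw; replace (xi - w) with ((x - contact beta w t) / t)
      by (unfold contact, xi; field; lra).
    apply Rdiv_lt_0_compat; lra. }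
  assert (FF : Filter (vanishing_pressure n alpha rhom um rhop up)).
  { apply within_filter, filter_prod_filter; apply within_filter, locally_filter. }
  split; [| split].
  - intros Hx; specialize (Hl _ Hx).
    assert (H : vanishing_pressure n alpha rhom um rhop up
      (fun AB => rhoAB (fst AB) (snd AB) x t = rhom /\
                 uAB (fst AB) (snd AB) x t = um + beta * t)).
    (* Once c(rhom) < um - xi, the point lies to the left of the whole 1-fan, so the datum is
       attained exactly and not only in the limit. *)
    { apply (vanishing_pressure_sound_speed _ _ _ _ _ _ rhom (um - xi)); try lra.
      intros A B HA HB HI Hs.
      destruct (hAB A B HA HB HI) as (rhos & vs & _ & _ & _ & H).
      destruct (H x t Ht) as (H1 & _); apply H1; fold xi; lra. }
    split; (apply filterlim_of_eventually_eq; [exact FF |]);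
      refine (@filter_imp _ _ FF _ _ _ H); tauto.
  - intros [Hxm Hxp]; specialize (Hl _ Hxp); specialize (Hr _ Hxm).
    apply filterlim_locally; intros eps.
    (* Halving [eps] makes the nonstrict density bound strict; halving the distance to the nearer of
       [um] and [up] leaves [xi] strictly inside both margins. *)
    set (e := eps / 2).
    assert (He : 0 < e) by (unfold e; destruct eps; simpl; lra).
    set (d := Rmin (up - xi) (xi - um) / 2).
    assert (Hd : 0 < d) by (unfold d; apply Rmin_case; lra).
    assert (Hdl := Rmin_l (up - xi) (xi - um)).
    assert (Hdr := Rmin_r (up - xi) (xi - um)).
    set (m := Rmax rhom rhop).
    assert (Hm : 0 < m) by (unfold m; apply Rmax_case; lra).
    assert (H1 : 0 < Rpower m (n - 1)) by apply exp_pos.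
    assert (H2 : 0 < Rpower e (- alpha - 1)) by apply exp_pos.
    (* The threshold d / m * e is the value s solving m * (s / e) = d. *)
    apply (vanishing_pressure_small _ _ _ _ _ _
             (n * Rpower m (n - 1)) (alpha * Rpower e (- alpha - 1)) (d / m * e));
      [nra | nra | |].
    { apply Rmult_lt_0_compat; [apply Rdiv_lt_0_compat |]; lra. }
    intros A B HA HB HI Hs; simpl.
    assert (Hrho : 0 < rhoAB A B x t <= e).
    { apply (two_rarefaction_density_le beta n alpha rhom um rhop up A B e d x t
               (rhoAB A B) (uAB A B)); try lra.
      - fold xi; unfold d in *; lra.
      - fold m; set (S := sqrt _) in *.
        replace d with (m * ((d / m * e) / e)) by (field; lra).
        apply Rmult_lt_compat_l; [lra |].
        apply Rmult_lt_compat_r; [apply Rinv_0_lt_compat |]; lra.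
      - now apply hAB. }
    change (Rabs (rhoAB A B x t - 0) < eps).
    rewrite Rabs_pos_eq by lra; unfold e in *; destruct eps; simpl in *; lra.
  - intros Hx; specialize (Hr _ Hx).
    assert (H : vanishing_pressure n alpha rhom um rhop up
      (fun AB => rhoAB (fst AB) (snd AB) x t = rhop /\
                 uAB (fst AB) (snd AB) x t = up + beta * t)).
    { apply (vanishing_pressure_sound_speed _ _ _ _ _ _ rhop (xi - up)); try lra.
      intros A B HA HB HI Hs.
      destruct (hAB A B HA HB HI) as (rhos & vs & _ & _ & _ & H).
      destruct (H x t Ht) as (_ & _ & _ & _ & H5); apply H5; fold xi; lra. }
    split; (apply filterlim_of_eventually_eq; [exact FF |]);
      refine (@filter_imp _ _ FF _ _ _ H); tauto.
Qed.

(** * Integrals with parameters and transported test functions *)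

Lemma continuous_affine (p q x : R) : continuous (fun y => p * y + q) x.
Proof.
  apply (ex_derive_continuous (V := R_NormedModule)); auto_derive; exact I.
Qed.

Lemma continuity_2d_pt_swap (f : R -> R -> R) (x y : R) :
  continuity_2d_pt f x y -> continuity_2d_pt (fun u v => f v u) y x.
Proof.
  intros H eps; destruct (H eps) as [d Hd]; exists d.
  intros u v Hu Hv; now apply Hd.
Qed.

Lemma continuity_2d_pt_continuous_snd (f : R -> R -> R) (x y : R) :
  continuity_2d_pt f x y -> continuous (f x) y.
Proof.
  intros H; apply filterlim_locally; intros eps.
  destruct (H eps) as [d Hd]; exists d; intros z Hz.
  apply Hd; [rewrite Rminus_diag, Rabs_R0; apply cond_pos | exact Hz].
Qed.

Lemma ex_RInt_continuity_2d (f : R -> R -> R) (a b s : R) :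
  (forall s x, continuity_2d_pt f s x) -> ex_RInt (f s) a b.
Proof.
  intros H; apply (ex_RInt_continuous (V := R_CompleteNormedModule)).
  intros z _; now apply continuity_2d_pt_continuous_snd.
Qed.

(** By compactness of [0, 1], [f s] is uniformly close to [f t] there for [s] near [t]. *)
Lemma continuous_RInt_param (f : R -> R -> R) (t : R) :
  (forall x, continuity_2d_pt f t x) ->
  (forall s, ex_RInt (f s) 0 1) ->
  continuous (fun s => RInt (f s) 0 1) t.
Proof.
  intros Hc Hi; apply filterlim_locally; intros eps.
  assert (He : 0 < eps / 2) by (destruct eps; simpl; lra).
  destruct (uniform_continuity_2d_1d' f 0 1 t (fun x _ => Hc x) (mkposreal _ He))
    as [d Hd].
  exists d; intros s Hs.
  apply Rabs_def2 in Hs; unfold minus, plus, opp in Hs; simpl in Hs.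
  change (Rabs (RInt (f s) 0 1 - RInt (f t) 0 1) < eps).
  assert (E : RInt (fun x => f s x - f t x) 0 1 = RInt (f s) 0 1 - RInt (f t) 0 1).
  { apply (RInt_minus (V := R_CompleteNormedModule)); apply Hi. }
  rewrite <- E.
  apply Rle_lt_trans with ((1 - 0) * (eps / 2)); [| lra].
  apply abs_RInt_le_const; [lra | |].
  - apply (ex_RInt_minus (V := R_NormedModule)); apply Hi.
  - intros x Hx; left.
    apply (Hd x t x s); try lra.
    rewrite Rminus_diag, Rabs_R0; apply cond_pos.
Qed.

(** The substitution x = (b s - a) y + a moves the variable bound into the integrand over the fixed
    interval [0, 1], whatever the order of [a] and [b s]. *)
Lemma continuous_RInt_param_bound (f : R -> R -> R) (a : R) (b : R -> R) (t : R) :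
  (forall s x, continuity_2d_pt f s x) -> continuous b t ->
  continuous (fun s => RInt (f s) a (b s)) t.
Proof.
  intros Hf Hb.
  apply (continuous_ext
    (fun s => (b s - a) * RInt (fun y => f s ((b s - a) * y + a)) 0 1)).
  { intros s.
    assert (E := RInt_comp_lin (V := R_CompleteNormedModule) (f s) (b s - a) a 0 1).
    replace ((b s - a) * 0 + a) with a in E by ring.
    replace ((b s - a) * 1 + a) with (b s) in E by ring.
    rewrite <- E by now apply ex_RInt_continuity_2d.
    symmetry; apply (RInt_scal (V := R_CompleteNormedModule)).
    apply (ex_RInt_continuous (V := R_CompleteNormedModule)); intros y _.
    apply (continuous_comp (fun y => (b s - a) * y + a) (f s)).
    - apply continuous_affine.
    - now apply continuity_2d_pt_continuous_snd. }
  apply (continuous_mult (K := R_AbsRing)).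
  { apply (continuous_minus (V := R_NormedModule)); [exact Hb | apply continuous_const]. }
  apply continuous_RInt_param.
  - intros y; apply continuity_2d_pt_filterlim.
    apply (filterlim_comp_2 (F := locally (t, y)) (G := locally t)
      (H := locally ((b t - a) * y + a))
      (fun z : R * R => fst z) (fun z => (b (fst z) - a) * snd z + a) f).
    + apply (continuous_fst (U := R_UniformSpace) (V := R_UniformSpace) t y).
    + apply (continuous_plus (V := R_NormedModule)
        (fun z : R * R => (b (fst z) - a) * snd z) (fun _ => a) (t, y)).
      * apply (continuous_mult (K := R_AbsRing)
          (fun z : R * R => b (fst z) - a) snd (t, y));
          [| apply (continuous_snd (U := R_UniformSpace) (V := R_UniformSpace) t y)].
        apply (continuous_minus (V := R_NormedModule)
          (fun z : R * R => b (fst z)) (fun _ => a) (t, y)); [| apply continuous_const].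
        apply (continuous_comp fst b);
          [apply (continuous_fst (U := R_UniformSpace) (V := R_UniformSpace) t y) | exact Hb].
      * apply continuous_const.
    (* A ball of the plane contains a product of balls, so joint continuity of [f] gives a limit
       along the product filter. *)
    + intros P HP.
      assert (H := proj1 (continuity_2d_pt_filterlim f _ _) (Hf t ((b t - a) * y + a)) P HP).
      destruct H as [d Hd].
      exists (ball t d) (ball ((b t - a) * y + a) d); try apply locally_ball.
      intros u v Hu Hv; apply (Hd (u, v)); split; assumption.
  - intros s; apply (ex_RInt_continuous (V := R_CompleteNormedModule)); intros y _.
    apply (continuous_comp (fun y => (b s - a) * y + a) (f s)).
    + apply continuous_affine.
    + now apply continuity_2d_pt_continuous_snd.
Qed.

(** The integrand [h] of [weak_balance_law] for a density [k] moving with velocity [w] and source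
    k'. The argument [dk] stands for k', and [t] comes first so that a partial application is a
    function of [x]. *)
Definition transported (k w dk : R -> R) (phi : R -> R -> R) (t x : R) : R :=
  k t * Derive (fun s => phi x s) t + k t * w t * Derive (fun y => phi y t) x
  + dk t * phi x t.

Lemma Derive_zero_outside (f : R -> R) (M x : R) :
  (forall y, M <= Rabs y -> f y = 0) -> M < Rabs x -> Derive f x = 0.
Proof.
  intros Hf Hx.
  rewrite (Derive_ext_loc f (fun _ => 0)); [apply Derive_const |].
  assert (Hd : 0 < Rabs x - M) by lra.
  exists (mkposreal _ Hd); intros y Hy; apply Hf.
  change (Rabs (y - x) < Rabs x - M) in Hy.
  assert (H := Rabs_triang_inv x y); rewrite (Rabs_minus_sym x y) in H; lra.
Qed.

Lemma test_function_continuous (phi : R -> R -> R) (M t x : R) :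
  test_function phi M -> continuous (fun y => phi y t) x.
Proof.
  intros (_ & _ & Hd & _); apply (ex_derive_continuous (V := R_NormedModule)).
  exact (proj1 (Hd x t)).
Qed.

(** Time is put first here and in [test_function_dx], because the results on parametric integrals
    expect the parameter as first argument. *)
Lemma test_function_dt (phi : R -> R -> R) (M t x : R) :
  test_function phi M ->
  continuity_2d_pt (fun s y => Derive (fun r => phi y r) s) t x.
Proof.
  intros (_ & _ & _ & Hc).
  apply (continuity_2d_pt_swap (fun y s => Derive (fun r => phi y r) s)).
  exact (proj2 (Hc x t)).
Qed.

Lemma test_function_dx (phi : R -> R -> R) (M t x : R) :
  test_function phi M ->
  continuity_2d_pt (fun s y => Derive (fun z => phi z s) y) t x.
Proof.
  intros (_ & _ & _ & Hc).
  apply (continuity_2d_pt_swap (fun y s => Derive (fun z => phi z s) y)).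
  exact (proj1 (Hc x t)).
Qed.

Lemma test_function_ex_RInt (phi : R -> R -> R) (M t a b : R) :
  test_function phi M -> ex_RInt (fun x => phi x t) a b.
Proof.
  intros H; apply (ex_RInt_continuous (V := R_CompleteNormedModule)).
  intros z _; now apply (test_function_continuous phi M).
Qed.

Lemma transported_continuous (k w dk : R -> R) (phi : R -> R -> R) (M t x : R) :
  test_function phi M -> continuous (transported k w dk phi t) x.
Proof.
  intros H.
  assert (C1 := continuity_2d_pt_continuous_snd _ _ _ (test_function_dt phi M t x H)).
  assert (C2 := continuity_2d_pt_continuous_snd _ _ _ (test_function_dx phi M t x H)).
  assert (C3 := test_function_continuous phi M t x H).
  exact (continuous_plus (V := R_NormedModule) _ _ x
    (continuous_plus (V := R_NormedModule) _ _ x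
      (continuous_mult (K := R_AbsRing) _ _ x (continuous_const (k t) x) C1)
      (continuous_mult (K := R_AbsRing) _ _ x (continuous_const (k t * w t) x) C2))
    (continuous_mult (K := R_AbsRing) _ _ x (continuous_const (dk t) x) C3)).
Qed.

Lemma transported_ex_RInt (k w dk : R -> R) (phi : R -> R -> R) (M t a b : R) :
  test_function phi M -> ex_RInt (transported k w dk phi t) a b.
Proof.
  intros H; apply (ex_RInt_continuous (V := R_CompleteNormedModule)).
  intros z _; now apply (transported_continuous k w dk phi M).
Qed.

(** At fixed time the coefficients leave the integral, which reduces differentiation and continuity
    to integrals of [phi] and its partial derivatives. *)
Lemma RInt_transported (k w dk : R -> R) (phi : R -> R -> R) (M t a b : R) :
  test_function phi M ->
  RInt (transported k w dk phi t) a b =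
  k t * (RInt (fun x => Derive (fun s => phi x s) t) a b
         + w t * RInt (fun x => Derive (fun y => phi y t) x) a b)
  + dk t * RInt (fun x => phi x t) a b.
Proof.
  intros H; apply is_RInt_unique.
  assert (I1 := RInt_correct _ _ _ (ex_RInt_continuity_2d
    (fun s y => Derive (fun r => phi y r) s) a b t
    (fun s x => test_function_dt phi M s x H))).
  assert (I2 := RInt_correct _ _ _ (ex_RInt_continuity_2d
    (fun s y => Derive (fun z => phi z s) y) a b t
    (fun s x => test_function_dx phi M s x H))).
  assert (I3 := RInt_correct _ _ _ (test_function_ex_RInt phi M t a b H)).
  assert (I := is_RInt_plus _ _ _ _ _ _
    (is_RInt_plus _ _ _ _ _ _ (is_RInt_scal _ _ _ (k t) _ I1)
       (is_RInt_scal _ _ _ (k t * w t) _ I2)) (is_RInt_scal _ _ _ (dk t) _ I3)).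
  unfold plus, scal in I; simpl in I; unfold mult in I; simpl in I.
  replace (k t * _ + _) with
   (k t * RInt (fun y : R => Derive (fun r : R => phi y r) t) a b +
     k t * w t * RInt (fun y : R => Derive (fun z : R => phi z t) y) a b +
     dk t * RInt (fun x : R => phi x t) a b) by ring.
  exact I.
Qed.

(** Leibniz rule; the lower bound is fixed, so only the moving end contributes a boundary term. *)
Lemma is_derive_RInt_moving_bound (X : R -> R) (dX : R) (phi : R -> R -> R) (M a t : R) :
  test_function phi M -> is_derive X t dX ->
  is_derive (fun s => RInt (fun x => phi x s) a (X s)) t
    (RInt (fun x => Derive (fun s => phi x s) t) a (X t) + phi (X t) t * dX).
Proof.
  intros H HX.
  assert (Hd := proj1 (proj2 (proj2 H))).
  apply (is_derive_RInt_param_bound_comp_aux3 (fun s x => phi x s)).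
  - apply filter_forall; intros; now apply (test_function_ex_RInt phi M).
  - exists (mkposreal 1 Rlt_0_1).
    apply filter_forall; intros; now apply (test_function_ex_RInt phi M).
  - exact HX.
  - exists (mkposreal 1 Rlt_0_1).
    apply filter_forall; intros s x _; exact (proj2 (Hd x s)).
  - intros; now apply (test_function_dt phi M).
  - apply locally_2d_forall; intros; now apply (test_function_dt phi M).
  - apply continuity_pt_filterlim; now apply (test_function_continuous phi M).
Qed.

(** Since [phi] vanishes at [a], the boundary term phi(X t, t) w(t) of the Leibniz rule is w(t)
    times the integral of phi_x; the product rule supplies the term in k'. *)
Lemma is_derive_transport (k w dk X : R -> R) (phi : R -> R -> R) (M a t : R) :
  test_function phi M -> phi a t = 0 ->
  is_derive k t (dk t) -> is_derive X t (w t) ->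
  is_derive (fun s => k s * RInt (fun x => phi x s) a (X s)) t
    (RInt (transported k w dk phi t) a (X t)).
Proof.
  intros H Ha Hk HX.
  assert (Hd := proj1 (proj2 (proj2 H))).
  assert (HJ := is_derive_RInt_moving_bound X (w t) phi M a t H HX).
  rewrite (RInt_transported k w dk phi M) by assumption.
  rewrite (RInt_Derive (fun y => phi y t)).
  2: { intros x _; exact (proj1 (Hd x t)). }
  2: { intros x _.
       apply (continuity_2d_pt_continuous_snd (fun s y => Derive (fun z => phi z s) y)).
       now apply (test_function_dx phi M). }
  assert (HG := is_derive_mult _ _ _ _ _ Hk HJ Rmult_comm).
  unfold plus, mult in HG; simpl in HG.
  rewrite Ha.
  replace (k t * _ + _) with
    (dk t * RInt (fun x => phi x t) a (X t) +
     k t * (RInt (fun x => Derive (fun s => phi x s) t) a (X t) + phi (X t) t * w t))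
    by ring.
  exact HG.
Qed.

(** Provides the continuity of the derivative that the fundamental theorem of calculus in time asks
    for. *)
Lemma continuous_RInt_transported (k w dk X : R -> R) (phi : R -> R -> R) (M a t : R) :
  test_function phi M ->
  is_derive k t (dk t) -> is_derive X t (w t) ->
  continuous w t -> continuous dk t ->
  continuous (fun s => RInt (transported k w dk phi s) a (X s)) t.
Proof.
  intros H Hk HX Hw Hdk.
  assert (Ck : continuous k t)
    by (apply (ex_derive_continuous (V := R_NormedModule)); now exists (dk t)).
  assert (CX : continuous X t)
    by (apply (ex_derive_continuous (V := R_NormedModule)); now exists (w t)).
  apply (continuous_ext _ _ _ (fun s => eq_sym (RInt_transported k w dk phi M s a (X s) H))).
  apply (continuous_plus (V := R_NormedModule));
    apply (continuous_mult (K := R_AbsRing)); try assumption.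
  - apply (continuous_plus (V := R_NormedModule)).
    + apply (continuous_RInt_param_bound (fun s y => Derive (fun r => phi y r) s));
        [| exact CX].
      intros; now apply (test_function_dt phi M).
    + apply (continuous_mult (K := R_AbsRing)); [exact Hw |].
      apply (continuous_RInt_param_bound (fun s y => Derive (fun z => phi z s) y));
        [| exact CX].
      intros; now apply (test_function_dx phi M).
  - apply (ex_derive_continuous (V := R_NormedModule)).
    eexists; exact (is_derive_RInt_moving_bound X (w t) phi M a t H HX).
Qed.

(** * Piecewise integrals and the weak formulation *)

Lemma is_RInt_zero_ext (f : R -> R) (a b : R) :
  (forall x, Rmin a b < x < Rmax a b -> f x = 0) -> is_RInt f a b 0.
Proof.
  intros Hf; apply (is_RInt_ext (fun _ => 0)); [intros; symmetry; auto |].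
  assert (H := is_RInt_const a b (0 : R_NormedModule)).
  unfold scal in H; simpl in H; unfold mult in H; simpl in H.
  now rewrite Rmult_0_r in H.
Qed.

(** The weak form integrates over [-M, M], but the curves may leave this interval; a larger [-K, K]
    contains them, and the added strips contribute zero. *)
Lemma is_RInt_restrict_support (h : R -> R) (M K l : R) :
  0 < M <= K -> (forall x, M < Rabs x -> h x = 0) ->
  is_RInt h (- K) K l -> is_RInt h (- M) M l.
Proof.
  intros HM Hs HI.
  assert (Z1 : is_RInt h (- K) (- M) 0).
  { apply is_RInt_zero_ext; intros x; rewrite Rmin_left, Rmax_right by lra.
    intros Hx; apply Hs; rewrite Rabs_left; lra. }
  assert (Z2 : is_RInt h M K 0).
  { apply is_RInt_zero_ext; intros x; rewrite Rmin_left, Rmax_right by lra.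
    intros Hx; apply Hs; rewrite Rabs_pos_eq; lra. }
  apply is_RInt_swap in Z1; apply is_RInt_swap in Z2.
  assert (I := is_RInt_Chasles _ _ _ _ _ _ (is_RInt_Chasles _ _ _ _ _ _ Z1 HI) Z2).
  unfold plus, opp in I; simpl in I.
  now replace (- 0 + l + - 0) with l in I by ring.
Qed.

(** The right piece is integrated backwards from [K], so that both pieces run from a fixed point
    outside the support to a moving curve, as in [is_RInt_transport]. *)
Lemma is_RInt_piecewise (h hl hr : R -> R) (M K b c : R) :
  0 < M <= K -> - K < b < c -> c < K ->
  (forall x, M < Rabs x -> h x = 0) ->
  (forall x, x < b -> h x = hl x) -> (forall x, b < x < c -> h x = 0) ->
  (forall x, c < x -> h x = hr x) ->
  ex_RInt hl (- K) b -> ex_RInt hr K c ->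
  is_RInt h (- M) M (RInt hl (- K) b - RInt hr K c).
Proof.
  intros HM Hb Hc Hs Hl Hz Hr Il Ir.
  apply (is_RInt_restrict_support h M K); try assumption.
  replace (RInt hl (- K) b - RInt hr K c)
    with (plus (plus (RInt hl (- K) b) 0) (opp (RInt hr K c)))
    by (unfold plus, opp; simpl; ring).
  apply (is_RInt_Chasles h (- K) c K); [apply (is_RInt_Chasles h (- K) b c) |].
  - apply (is_RInt_ext hl); [| exact (RInt_correct hl _ _ Il)].
    intros x; rewrite Rmin_left, Rmax_right by lra; intros; symmetry; apply Hl; lra.
  - apply is_RInt_zero_ext.
    intros x; rewrite Rmin_left, Rmax_right by lra; apply Hz.
  - apply (is_RInt_swap (V := R_NormedModule)), (is_RInt_ext hr);
      [| exact (RInt_correct hr _ _ Ir)].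
    intros x; rewrite Rmin_right, Rmax_left by lra; intros; symmetry; apply Hr; lra.
Qed.

(** Fundamental theorem of calculus in time: [phi] vanishes at time [M], so only the initial term
    survives. *)
Lemma is_RInt_transport (k w dk X : R -> R) (phi : R -> R -> R) (M a : R) :
  test_function phi M -> (forall t, phi a t = 0) -> X 0 = 0 ->
  (forall t, is_derive k t (dk t)) -> (forall t, is_derive X t (w t)) ->
  (forall t, continuous w t) -> (forall t, continuous dk t) ->
  is_RInt (fun t => RInt (transported k w dk phi t) a (X t)) 0 M
    (- (k 0 * RInt (fun x => phi x 0) a 0)).
Proof.
  intros H Ha HX0 Hk HX Hw Hdk.
  replace (- (k 0 * RInt (fun x => phi x 0) a 0))
    with (k M * RInt (fun x => phi x M) a (X M) - k 0 * RInt (fun x => phi x 0) a (X 0)).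
  - apply (is_RInt_derive (V := R_CompleteNormedModule)
      (fun s => k s * RInt (fun x => phi x s) a (X s))); intros t _.
    + now apply (is_derive_transport k w dk X phi M).
    + now apply (continuous_RInt_transported k w dk X phi M).
  - rewrite HX0.
    rewrite (is_RInt_unique (fun x => phi x M) a (X M) 0); [ring |].
    apply is_RInt_zero_ext; intros x _; apply H; right; apply Rle_refl.
Qed.

(** Brings the initial term to the same form, two integrals based at -K and K. *)
Lemma initial_data_integral (q0 : R -> R) (kl kr M K : R) (f : R -> R) :
  0 < M <= K -> (forall x, M < Rabs x -> f x = 0) -> (forall x, continuous f x) ->
  (forall x, x < 0 -> q0 x = kl) -> (forall x, 0 < x -> q0 x = kr) ->
  RInt (fun x => q0 x * f x) (- M) M = kl * RInt f (- K) 0 - kr * RInt f K 0.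
Proof.
  intros HM Hf Hc Hl Hr; apply is_RInt_unique.
  assert (Hi : forall a b, ex_RInt f a b).
  { intros; apply (ex_RInt_continuous (V := R_CompleteNormedModule)); auto. }
  apply (is_RInt_restrict_support _ M K); [lra | intros; rewrite Hf by assumption; ring |].
  replace (kl * RInt f (- K) 0 - kr * RInt f K 0)
    with (plus (kl * RInt f (- K) 0) (opp (kr * RInt f K 0))) by reflexivity.
  apply (is_RInt_Chasles (V := R_NormedModule) _ (- K) 0 K).
  - apply (is_RInt_ext (fun x => scal kl (f x))).
    + intros x; rewrite Rmin_left, Rmax_right by lra; intros; rewrite Hl by lra; reflexivity.
    + exact (is_RInt_scal (V := R_NormedModule) f _ _ _ _ (RInt_correct f _ _ (Hi _ _))).
  - apply (is_RInt_swap (V := R_NormedModule)), (is_RInt_ext (fun x => scal kr (f x))).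
    + intros x; rewrite Rmin_right, Rmax_left by lra; intros; rewrite Hr by lra; reflexivity.
    + exact (is_RInt_scal (V := R_NormedModule) f _ _ _ _ (RInt_correct f _ _ (Hi _ _))).
Qed.

Lemma continuous_abs_bounded (X : R -> R) (M : R) :
  0 <= M -> (forall t, continuous X t) ->
  exists K, forall t, 0 <= t <= M -> Rabs (X t) <= K.
Proof.
  intros HM HX.
  destruct (continuity_ab_maj (fun t => Rabs (X t)) 0 M HM) as (t0 & H0 & _).
  - intros t _; apply continuity_pt_filterlim.
    apply (continuous_comp X Rabs); [apply HX | apply continuous_Rabs].
  - now exists (Rabs (X t0)).
Qed.

(** Covers mass and momentum at once: each side of the vacuum is one use of [is_RInt_transport],
    based at -K on the left and at K on the right, and the vacuum contributes nothing. *)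
Lemma weak_balance_law_vacuum_between
    (q f g : R -> R -> R) (q0 : R -> R)
    (kl wl dkl Xl kr wr dkr Xr : R -> R) :
  Xl 0 = 0 -> Xr 0 = 0 -> (forall t, 0 < t -> Xl t < Xr t) ->
  (forall t, is_derive kl t (dkl t)) -> (forall t, is_derive Xl t (wl t)) ->
  (forall t, continuous wl t) -> (forall t, continuous dkl t) ->
  (forall t, is_derive kr t (dkr t)) -> (forall t, is_derive Xr t (wr t)) ->
  (forall t, continuous wr t) -> (forall t, continuous dkr t) ->
  (forall x t, 0 < t -> x < Xl t ->
     q x t = kl t /\ f x t = kl t * wl t /\ g x t = dkl t) ->
  (forall x t, 0 < t -> Xl t < x < Xr t -> q x t = 0 /\ f x t = 0 /\ g x t = 0) ->
  (forall x t, 0 < t -> Xr t < x ->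
     q x t = kr t /\ f x t = kr t * wr t /\ g x t = dkr t) ->
  (forall x, x < 0 -> q0 x = kl 0) -> (forall x, 0 < x -> q0 x = kr 0) ->
  weak_balance_law q f g q0.
Proof.
  intros Xl0 Xr0 Hlr Dkl DXl Cwl Cdkl Dkr DXr Cwr Cdkr Hl Hz Hr Hql Hqr phi M H h.
  assert (HM : 0 < M) by apply H.
  assert (Hs := proj1 (proj2 H)).
  destruct (continuous_abs_bounded Xl M) as [K1 HK1]; [lra | |].
  { intros t; apply (ex_derive_continuous (V := R_NormedModule)); eexists; apply DXl. }
  destruct (continuous_abs_bounded Xr M) as [K2 HK2]; [lra | |].
  { intros t; apply (ex_derive_continuous (V := R_NormedModule)); eexists; apply DXr. }
  assert (Hh0 : forall t x, M < Rabs x -> h t x = 0).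
  { intros t x Hx; unfold h.
    rewrite (Derive_zero_outside (fun y => phi y t) M) by (auto using Rle_refl).
    rewrite (Derive_ext (fun s => phi x s) (fun _ => 0)) by (intros; apply Hs; lra).
    rewrite Derive_const, Hs by lra; ring. }
  assert (Hint : forall t K, 0 < t -> M <= K -> Rabs (Xl t) < K -> Rabs (Xr t) < K ->
    is_RInt (h t) (- M) M (RInt (transported kl wl dkl phi t) (- K) (Xl t)
                           - RInt (transported kr wr dkr phi t) K (Xr t))).
  { intros t K Ht HMK HlK HrK.
    apply Rabs_def2 in HlK; apply Rabs_def2 in HrK; specialize (Hlr t Ht).
    apply is_RInt_piecewise; try lra; try (now apply (transported_ex_RInt _ _ _ _ M)).
    - apply Hh0.
    - intros x Hx; destruct (Hl x t Ht Hx) as (E1 & E2 & E3).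
      unfold h; rewrite E1, E2, E3; reflexivity.
    - intros x Hx; destruct (Hz x t Ht Hx) as (E1 & E2 & E3).
      unfold h; rewrite E1, E2, E3; ring.
    - intros x Hx; destruct (Hr x t Ht Hx) as (E1 & E2 & E3).
      unfold h; rewrite E1, E2, E3; reflexivity. }
  split.
  - intros t Ht; eexists.
    (* Integrability is asked for at every t > 0, so [K] depends on [t] here; the time integral
       below needs one [K] for all t in [0, M]. *)
    apply (Hint t (M + Rabs (Xl t) + Rabs (Xr t) + 1)); try easy;
      assert (A1 := Rabs_pos (Xl t)); assert (A2 := Rabs_pos (Xr t)); lra.
  - set (K := M + Rabs K1 + Rabs K2 + 1).
    assert (A1 := Rle_abs K1); assert (A2 := Rle_abs K2).
    assert (A3 := Rabs_pos K1); assert (A4 := Rabs_pos K2).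
    assert (HMK : M <= K) by (unfold K; lra).
    apply (is_RInt_ext (fun t => RInt (transported kl wl dkl phi t) (- K) (Xl t)
                                 - RInt (transported kr wr dkr phi t) K (Xr t))).
    { intros t; rewrite Rmin_left, Rmax_right by lra; intros Ht.
      specialize (HK1 t ltac:(lra)); specialize (HK2 t ltac:(lra)).
      symmetry; apply is_RInt_unique, Hint; unfold K; lra. }
    rewrite (initial_data_integral q0 (kl 0) (kr 0) M K (fun x => phi x 0)); try assumption.
    2: lra.
    2: { intros x Hx; apply Hs; lra. }
    2: { intros x; now apply (test_function_continuous phi M). }
    assert (Z : forall t, phi K t = 0 /\ phi (- K) t = 0).
    { intros t; split; apply Hs; left; [| rewrite Rabs_Ropp]; rewrite Rabs_pos_eq; lra. }
    assert (I := is_RInt_minus (V := R_NormedModule) _ _ _ _ _ _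
      (is_RInt_transport kl wl dkl Xl phi M (- K) H (fun t => proj2 (Z t)) Xl0 Dkl DXl Cwl Cdkl)
      (is_RInt_transport kr wr dkr Xr phi M K H (fun t => proj1 (Z t)) Xr0 Dkr DXr Cwr Cdkr)).
    unfold minus, plus, opp in I; simpl in I.
    replace (- (kl 0 * _ - _)) with (- (kl 0 * RInt (fun x => phi x 0) (- K) 0)
      + - - (kr 0 * RInt (fun x => phi x 0) K 0)) by ring.
    exact I.
Qed.

(** * The pressureless Riemann problem *)

Lemma is_derive_contact (beta w t : R) :
  is_derive (contact beta w) t (w + beta * t).
Proof. unfold contact; auto_derive; [exact I | field]. Qed.

Lemma is_derive_linear_velocity (beta w t : R) :
  is_derive (fun s => w + beta * s) t beta.
Proof. auto_derive; [exact I | ring]. Qed.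

Lemma contact_lt (beta w1 w2 t : R) :
  w1 < w2 -> 0 < t -> contact beta w1 t < contact beta w2 t.
Proof.
  intros Hw Ht; unfold contact; assert (H := Rmult_lt_compat_r t _ _ Ht Hw); lra.
Qed.

Lemma eq_of_eq_derivative (f g df : R -> R) (t : R) :
  (forall s, 0 <= s -> is_derive f s (df s)) ->
  (forall s, 0 <= s -> is_derive g s (df s)) ->
  f 0 = g 0 -> 0 < t -> f t = g t.
Proof.
  intros Hf Hg H0 Ht.
  assert (E : f 0 - g 0 = f t - g t).
  { apply (eq_is_derive (V := R_NormedModule) (fun s => f s - g s) 0 t); [| exact Ht].
    intros s [Hs _].
    assert (D := is_derive_minus (V := R_NormedModule) f g s _ _ (Hf s Hs) (Hg s Hs)).
    rewrite minus_eq_zero in D; exact D. }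
  lra.
Qed.

Lemma characteristic_contact (beta x0 w : R) :
  characteristic beta x0 w (fun t => x0 + contact beta w t) (fun t => w + beta * t).
Proof.
  split; [unfold contact; ring | split; [ring |]].
  intros t; split; [| apply is_derive_linear_velocity].
  unfold contact; auto_derive; [exact I | field].
Qed.

(** The system is triangular: U' = beta determines [U] on all of t >= 0, and then X' = U determines
    [X]. *)
Lemma characteristic_eq (beta x0 w : R) (X U : R -> R) (t : R) :
  characteristic beta x0 w X U -> 0 < t ->
  X t = x0 + contact beta w t /\ U t = w + beta * t.
Proof.
  intros (X0 & U0 & H) Ht.
  destruct (characteristic_contact beta x0 w) as (C0 & V0 & C).
  assert (HU : forall s, 0 <= s -> U s = w + beta * s).
  { intros s [Hs | <-]; [| now rewrite U0, V0].
    apply (eq_of_eq_derivative U (fun s => w + beta * s) (fun _ => beta));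
      try assumption; try (intros r _; first [apply H | apply C]).
    now rewrite U0, V0. }
  split; [| apply HU; lra].
  apply (eq_of_eq_derivative X (fun s => x0 + contact beta w s) U); try assumption.
  - intros s _; apply H.
  - intros s Hs; rewrite HU by exact Hs; apply C.
  - now rewrite X0, C0.
Qed.

Lemma two_contacts_weak_solution (beta rhom rhop um up : R) (rho u : R -> R -> R) :
  um < up -> two_contacts_with_vacuum beta rhom um rhop up rho u ->
  pressureless_weak_solution beta
    (riemann_data rhom rhop) (riemann_data um up) rho u.
Proof.
  intros Hu H.
  assert (Hneg : forall l r x, x < 0 -> riemann_data l r x = l).
  { intros l r x Hx; unfold riemann_data; destruct (Rlt_dec x 0); lra. }
  assert (Hpos : forall l r x, 0 < x -> riemann_data l r x = r).
  { intros l r x Hx; unfold riemann_data; destruct (Rlt_dec x 0); lra. }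
  assert (Cw : forall w t, continuous (fun s => w + beta * s) t).
  { intros w t; apply (ex_derive_continuous (V := R_NormedModule)).
    eexists; apply is_derive_linear_velocity. }
  assert (C0 : forall w, contact beta w 0 = 0) by (intros; unfold contact; ring).
  assert (Dm : forall r w t, is_derive (fun s => r * (w + beta * s)) t (r * beta)).
  { intros; auto_derive; [exact I | ring]. }
  split.
  - apply (weak_balance_law_vacuum_between _ _ _ _
      (fun _ => rhom) (fun t => um + beta * t) (fun _ => 0) (contact beta um)
      (fun _ => rhop) (fun t => up + beta * t) (fun _ => 0) (contact beta up));
      auto using is_derive_contact, contact_lt; intros.
    + apply (is_derive_const (V := R_NormedModule)).
    + apply continuous_const.
    + apply (is_derive_const (V := R_NormedModule)).
    + apply continuous_const.
    + destruct (proj1 (H x t H0) H1) as [-> ->]; auto.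
    + rewrite (proj1 (proj2 (H x t H0)) H1); repeat split; ring.
    + destruct (proj2 (proj2 (H x t H0)) H1) as [-> ->]; auto.
  (* Momentum: with k = r (w + beta t), the flux k w is rho u^2 and k' = r beta is the source. *)
  - apply (weak_balance_law_vacuum_between _ _ _ _
      (fun t => rhom * (um + beta * t)) (fun t => um + beta * t)
      (fun _ => rhom * beta) (contact beta um)
      (fun t => rhop * (up + beta * t)) (fun t => up + beta * t)
      (fun _ => rhop * beta) (contact beta up));
      auto using is_derive_contact, contact_lt; intros.
    + apply continuous_const.
    + apply continuous_const.
    + destruct (proj1 (H x t H0) H1) as [-> ->]; repeat split; ring.
    + rewrite (proj1 (proj2 (H x t H0)) H1); repeat split; ring.
    + destruct (proj2 (proj2 (H x t H0)) H1) as [-> ->]; repeat split; ring.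
    + rewrite !Hneg by assumption; ring.
    + rewrite !Hpos by assumption; ring.
Qed.

(** The characteristic of initial velocity [w] through (x, t) has foot x - contact(w, t); the sign
    of the foot tells on which side of the contact [x] lies. *)
Lemma two_contacts_iff_pressureless_riemann_solution
    (beta rhom rhop um up : R) (rho u : R -> R -> R) :
  um < up ->
  two_contacts_with_vacuum beta rhom um rhop up rho u <->
  pressureless_riemann_solution beta rhom um rhop up rho u.
Proof.
  intros Hu; split.
  - intros H; split; [now apply two_contacts_weak_solution |].
    split; [| split].
    + intros x0 X U Hx0 HX t Ht.
      destruct (characteristic_eq _ _ _ _ _ t HX Ht) as [-> ->].
      apply (proj1 (H _ t Ht)); lra.
    + intros x0 X U Hx0 HX t Ht.
      destruct (characteristic_eq _ _ _ _ _ t HX Ht) as [-> ->].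
      apply (proj2 (proj2 (H _ t Ht))); lra.
    + intros x t Ht Hno.
      (* A point on or outside a contact would be reached by a characteristic whose foot lies on the
         admissible closed half-line. *)
      apply (proj1 (proj2 (H x t Ht))); split; apply Rnot_le_lt; intros Hx.
      * apply (Hno (x - contact beta um t) um _ _ ltac:(left; split; [lra | reflexivity])
                 (characteristic_contact _ _ _)); ring.
      * apply (Hno (x - contact beta up t) up _ _ ltac:(right; split; [lra | reflexivity])
                 (characteristic_contact _ _ _)); ring.
  - intros (_ & Hl & Hr & Hv) x t Ht; split; [| split].
    + intros Hx.
      assert (H := Hl (x - contact beta um t) _ _ ltac:(lra)
                     (characteristic_contact _ _ _) t Ht).
      cbv beta in H.
      now replace (x - contact beta um t + contact beta um t) with x in H by ring.
    + intros Hx; apply Hv; [exact Ht |].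
      intros x0 w X U Hx0 HX; destruct (characteristic_eq _ _ _ _ _ t HX Ht) as [-> _].
      destruct Hx0 as [[Hx0 ->] | [Hx0 ->]]; lra.
    + intros Hx.
      assert (H := Hr (x - contact beta up t) _ _ ltac:(lra)
                     (characteristic_contact _ _ _) t Ht).
      cbv beta in H.
      now replace (x - contact beta up t + contact beta up t) with x in H by ring.
Qed.

Theorem theorem5p2 (beta n alpha rhom rhop um up : R)
    (hn : 1 <= n <= 3) (halpha : 0 < alpha <= 1)
    (hrhom : 0 < rhom) (hrhop : 0 < rhop) (hu : um < up)
    (rhoAB uAB : R -> R -> R -> R -> R)
    (hAB : forall A B : R, 0 < A -> 0 < B ->
       region_I n alpha rhom um rhop up A B ->
       two_rarefaction_solution beta n alpha rhom um rhop up A B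
         (rhoAB A B) (uAB A B)) :
  (forall x t : R, 0 < t ->
     let F := vanishing_pressure n alpha rhom um rhop up in
     let rho_xt := fun AB : R * R => rhoAB (fst AB) (snd AB) x t in
     let u_xt := fun AB : R * R => uAB (fst AB) (snd AB) x t in
     (x < um * t + / 2 * beta * t ^ 2 ->
        filterlim rho_xt F (locally rhom) /\
        filterlim u_xt F (locally (um + beta * t))) /\
     (um * t + / 2 * beta * t ^ 2 < x < up * t + / 2 * beta * t ^ 2 ->
        filterlim rho_xt F (locally 0)) /\
     (up * t + / 2 * beta * t ^ 2 < x ->
        filterlim rho_xt F (locally rhop) /\
        filterlim u_xt F (locally (up + beta * t)))) /\
  (forall rho u : R -> R -> R,
     two_contacts_with_vacuum beta rhom um rhop up rho u <->
     pressureless_riemann_solution beta rhom um rhop up rho u).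
Proof.
  split.
  - intros x t Ht.
    exact (two_rarefaction_limit beta n alpha rhom rhop um up hn halpha hrhom hrhop hu
             rhoAB uAB hAB x t Ht).
  - intros rho u; now apply two_contacts_iff_pressureless_riemann_solution.
Qed.
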